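(* Let $(X,\succcurlyeq^X)$, $(Y,\succcurlyeq^Y)$, $(U,\succcurlyeq^U)$ be posets, and let $C\subseteq X$ and $D\subseteq Y$ be nonempty chain-complete subsets of $(X,\succcurlyeq^X)$ and $(Y,\succcurlyeq^Y)$, respectively. Let $T:C\times D\to U$ be a single-valued mapping, let $F:C\to 2^D\setminus\{\emptyset\}$ and $G:D\to 2^C\setminus\{\emptyset\}$ be set-valued mappings, and let $\varphi:C\to 2^D\setminus\{\emptyset\}$ and $\psi:D\to 2^C\setminus\{\emptyset\}$ be the order-optimization mappings of $(T,F,G)$ (all their values being nonempty). Suppose that $\varphi$ and $\psi$ are both order-increasing upward, that $\varphi(x)$ is universally inductive in $(D,\succcurlyeq^Y)$ for every $x\in C$, and that $\psi(y)$ is universally inductive in $(C,\succcurlyeq^X)$ for every $y\in D$. If there are $(x',y')\in C\times D$, $u'\in\varphi(x')$ and $z'\in\psi(y')$ such that $$x'\preccurlyeq^X z'\quad\text{and}\quad y'\preccurlyeq^Y u',$$ then the solution set $\mathcal S(T,F,G)$ of the constrained ordered equilibrium problem $\mathrm{ROEP}(T,F,G)$ is a nonempty and inductive subset of $(C\times D,\succcurlyeq^{X\times Y})$, and $\mathrm{ROEP}(T,F,G)$ has an $\succcurlyeq^{X\times Y}$-maximal solution (i.e. $\mathcal S(T,F,G)$ has an $\succcurlyeq^{X\times Y}$-maximal element).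
   Context: For a partial order $\succcurlyeq$, $a\succ b$ means $a\succcurlyeq b$ and $a\ne b$; $\not\succ$ is its negation; $a \preccurlyeq b$ means $b\succcurlyeq a$. A point $a$ of a subset $A$ of a poset is $\succcurlyeq$-maximal (resp. $\succcurlyeq$-minimal) in $A$ if no $b\in A$ satisfies $b\succ a$ (resp. $a\succ b$). $\mathrm{ROEP}(T,F,G)$ is the problem of finding $x^*\in C$, $y^*\in D$ with $x^*\in G(y^* )$ and $y^*\in F(x^* )$ such that $T(x,y^* )\not\succ^U T(x^*,y^* )\not\succ^U T(x^*,y)$ for all $x\in G(y^* )$ and $y\in F(x^* )$. Such $(x^*,y^* )\in C\times D$ is a solution; $\mathcal S(T,F,G)$ is the set of all solutions. Order-optimization mappings: for $x\in C$, $\varphi(x)=\{z\in F(x): T(x,z)\text{ is an }\succcurlyeq^U\text{-minimal point of } T(x,F(x))\}$; for $y\in D$, $\psi(y)=\{u\in G(y): T(u,y)\text{ is an }\succcurlyeq^U\text{-maximal point of } T(G(y),y)\}$. Here $T(x,F(x))=\{T(x,z):z\in F(x)\}$ and $T(G(y),y)=\{T(u,y):u\in G(y)\}$. $\succcurlyeq^{X\times Y}$ is the componentwise order on $C\times D$: $(x_1,y_1)\preccurlyeq^{X\times Y}(x_2,y_2)$ iff $x_1\preccurlyeq^X x_2$ and $y_1\preccurlyeq^Y y_2$. A set-valued mapping $H:P\to 2^Q\setminus\{\emptyset\}$ between posets is order-increasing upward if $p_1\preccurlyeq p_2$ in $P$ and $q_1\in H(p_1)$ imply that there is $q_2\in H(p_2)$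 with $q_1\preccurlyeq q_2$. A poset (or subset with the induced order) is chain-complete if every nonempty chain in it has a least upper bound in it. A subset $A$ of a poset is inductive if every chain in $A$ has an upper bound in $A$. A nonempty subset $A$ of a poset $P$ is universally inductive in $P$ if every chain $\{x_\alpha\}\subseteq P$ such that for each $\alpha$ there is $a_\alpha\in A$ with $x_\alpha\preccurlyeq a_\alpha$ has an upper bound in $A$. *)

(* Defs.v *)
From mathcomp Require Import all_boot all_order.
From mathcomp Require Import boolp classical_sets.

Set Implicit Arguments.
Unset Strict Implicit.
Unset Printing Implicit Defensive.

Local Open Scope classical_set_scope.
Local Open Scope order_scope.

(* Subsets of a poset are given as sets of the ambient [porderType], with the
   induced order.  A mapping whose domain is such a subset is a total function
   on the ambient type; only its values on that subset are ever used. *)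

Section Poset.
Context {d : Order.disp_t} {P : porderType d}.
Implicit Types (A B K : set P) (a : P).

Definition maximal_in A a := A a /\ forall b, A b -> ~~ (b > a).

Definition minimal_in A a := A a /\ forall b, A b -> ~~ (a > b).

(* The empty set is a chain. *)
Definition chain K := total_on K <=%O.

(* [a] is a least upper bound of [K] within the poset [A]: only the upper
   bounds of [K] that lie in [A] are compared with [a]. *)
Definition lub_in A K a :=
  [/\ A a, ubound K a & forall b, A b -> ubound K b -> a <= b].

Definition chain_complete A :=
  forall K, K `<=` A -> K !=set0 -> chain K -> exists a, lub_in A K a.

Definition inductive A :=
  forall K, K `<=` A -> chain K -> exists2 a, A a & ubound K a.

Definition universally_inductive B A :=
  [/\ A `<=` B, A !=set0 &
      forall K, K `<=` B -> chain K ->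
        (forall x, K x -> exists2 a, A a & x <= a) ->
        exists2 a, A a & ubound K a].

End Poset.

(* [H] restricts to a mapping from [A] to the nonempty subsets of [B]. *)
Definition setvalued {P Q : Type} (A : set P) (B : set Q) (H : P -> set Q) :=
  forall p, A p -> H p `<=` B /\ H p !=set0.

Definition order_increasing_upward {dP dQ : Order.disp_t} {P : porderType dP}
    {Q : porderType dQ} (A : set P) (H : P -> set Q) :=
  forall p1 p2, A p1 -> A p2 -> p1 <= p2 ->
    forall q1, H p1 q1 -> exists2 q2, H p2 q2 & q1 <= q2.

Section OrderedEquilibrium.
Context {dX dY dU : Order.disp_t} {X : porderType dX} {Y : porderType dY}.
Context {U : porderType dU}.
Variables (C : set X) (D : set Y).
Variables (T : X -> Y -> U) (F : X -> set Y) (G : Y -> set X).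

Definition phi (x : X) : set Y :=
  [set z | F x z /\ minimal_in [set T x v | v in F x] (T x z)].

Definition psi (y : Y) : set X :=
  [set u | G y u /\ maximal_in [set T v y | v in G y] (T u y)].

(* [X *p Y] carries the componentwise order. *)
Definition ROEP_solutions : set (X *p Y) :=
  [set s | [/\ C s.1, D s.2, G s.2 s.1, F s.1 s.2 &
      forall x y, G s.2 x -> F s.1 y ->
        ~~ (T x s.2 > T s.1 s.2) /\ ~~ (T s.1 s.2 > T s.1 y)]].

End OrderedEquilibrium.

(* Main.v *)
Require Import Defs.
From mathcomp Require Import all_boot all_order.
From mathcomp Require Import boolp classical_sets.

Local Open Scope classical_set_scope.
Local Open Scope order_scope.

(** A pair [(x, y)] solves the equilibrium problem exactly when [x] lies in
    [psi y] and [y] lies in [phi x], that is, when it is a fixed point of the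
    set-valued mapping [(x, y) |-> psi y * phi x] of [C * D] into itself.
    Chain-completeness of the domain, universal inductivity of the values and
    upward monotonicity all pass from the factors to the componentwise order
    ([chain_complete_setX], [universally_inductive_setX],
    [equilibrium_map_increasing]), so the theorem is an instance of a fixed
    point theorem for one mapping [H] on a chain-complete poset
    ([fixed_points_inductive], [fixed_points_maximal]).

    That theorem rests on the set [E] ([postfixed_points]) of the points [p] lying below some value
    [q] in [H p].  Every fixed point is in [E], and [E] is inductive
    ([postfixed_inductive]): if a chain in [E] has supremum [s], monotonicity
    puts each of its members below a point of [H s], so universal inductivity
    gives a single point of [H s] above the whole chain, hence above [s].  A
    maximal point [p] of [E] is fixed, because monotonicity puts any [q >= p] in
    [H p] back into [E], which forces [q = p].  By Zorn's lemma every point of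
    [E] lies below such a maximal, hence fixed, point; this bounds chains of
    fixed points by fixed points and yields a maximal fixed point. *)

Section FixedPoints.
Context {d : Order.disp_t} {P : porderType d}.
Implicit Types (A : set P) (H : P -> set P).

(** Zorn's lemma relative to a subset and above a prescribed point. *)
Lemma inductive_maximal_above A a :
  inductive A -> A a -> exists2 m, maximal_in A m & a <= m.
Proof.
move=> indA Aa.
pose S := {x : P | A x /\ a <= x}.
pose R (s t : S) := sval s <= sval t.
have [|||B Btot|[m [Am am]] mmax] := @Zorn S R.
- by move=> s; exact: Order.POrderTheory.lexx.
- by move=> r s t; exact: Order.POrderTheory.le_trans.
- move=> [s Ps] [t Pt] st ts; apply: eq_exist.
  by apply: Order.POrderTheory.le_anti; apply/andP.
(* The point [a] is added to the chain so that the bound is above [a] even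
   when [B] is empty. *)
- have [||b Ab bub] := indA (a |` [set sval s | s in B]).
  + by move=> _ [->//|[s _ <-]]; exact: (svalP s).1.
  + move=> _ _ [->|[s Bs <-]] [->|[t Bt <-]].
    * by left.
    * by left; exact: (svalP t).2.
    * by right; exact: (svalP s).2.
    * exact: Btot.
  + have ab : a <= b by apply: bub; left.
    exists (exist _ b (conj Ab ab)) => s Bs.
    by apply: bub; right; exists s.
- exists m => //; split=> // b Ab; apply/negP => mb.
  have mleb := Order.POrderTheory.ltW mb.
  have ab := Order.POrderTheory.le_trans am mleb.
  have [bm] := mmax (exist _ b (conj Ab ab)) mleb.
  by rewrite bm Order.POrderTheory.ltxx in mb.
Qed.

Definition postfixed_points A H : set P :=
  [set p | A p /\ exists2 q, H p q & p <= q].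

Definition fixed_points A H : set P := [set p | A p /\ H p p].

Section FixedPointTheorem.
Context (A : set P) (H : P -> set P).
Hypotheses (ccA : chain_complete A) (H_incr : order_increasing_upward A H).
Hypothesis H_ind : forall p, A p -> universally_inductive A (H p).
Hypothesis start : postfixed_points A H !=set0.

Lemma fixed_sub_postfixed : fixed_points A H `<=` postfixed_points A H.
Proof. by move=> p [Ap Hp]; split=> //; exists p. Qed.

(** The supremum [s] of a chain in the set is itself in the set: each member of
    the chain is below a point of [H s] by monotonicity, and universal
    inductivity replaces these points, which need not form a chain, by a single
    one that bounds the whole chain. *)
Lemma postfixed_inductive : inductive (postfixed_points A H).
Proof.
move=> K KE chK.
have [->|/set0P K0] := eqVneq K set0; first by case: start => p Ep; exists p.
have KA : K `<=` A by move=> k /KE[].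
have [s [As sub slub]] := ccA _ KA K0 chK.
have [_ _ /(_ K KA chK)[k Kk|w Hw wub]] := H_ind _ As.
  have [Ak [q Hq kq]] := KE _ Kk.
  have [v Hv qv] := H_incr _ _ Ak As (sub _ Kk) _ Hq.
  by exists v => //; exact: Order.POrderTheory.le_trans qv.
have [HsA _ _] := H_ind _ As.
exists s => //; split=> //; exists w => //.
by apply: slub => //; exact: HsA.
Qed.

(** If [q] in [H p] is above [p], monotonicity applied to [p <= q] shows that [q]
    is again below one of its values, so maximality leaves only [q = p]. *)
Lemma maximal_postfixed_fixed p :
  maximal_in (postfixed_points A H) p -> fixed_points A H p.
Proof.
move=> [[Ap [q Hq pq]] pmax]; split=> //.
have [HpA _ _] := H_ind _ Ap.
have Aq : A q by exact: HpA.
have [v Hv qv] := H_incr _ _ Ap Aq pq _ Hq.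
have /pmax : postfixed_points A H q by split=> //; exists v.
by rewrite Order.POrderTheory.lt_neqAle pq andbT negbK => /eqP pE; rewrite {2}pE.
Qed.

(** The supremum of a chain of fixed points need not be fixed, but it is below
    one of its values, so Zorn's lemma finds a fixed point above it. *)
Lemma fixed_points_inductive : inductive (fixed_points A H).
Proof.
move=> K KF chK.
have KE := subset_trans KF fixed_sub_postfixed.
have [s Es sub] := postfixed_inductive _ KE chK.
have [m mmax sm] := inductive_maximal_above _ _ postfixed_inductive Es.
exists m; first exact: maximal_postfixed_fixed.
by move=> k /sub ks; exact: Order.POrderTheory.le_trans sm.
Qed.

Lemma fixed_points_maximal : exists p, maximal_in (fixed_points A H) p.
Proof.
have [p Ep] := start.
have [m mmax _] := inductive_maximal_above _ _ postfixed_inductive Ep.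
exists m; split; first exact: maximal_postfixed_fixed.
by move=> q /fixed_sub_postfixed; exact: mmax.2.
Qed.

End FixedPointTheorem.
End FixedPoints.

Section Products.
Context {dX dY : Order.disp_t} {X : porderType dX} {Y : porderType dY}.
Implicit Types (A C : set X) (B D : set Y) (K : set (X *p Y)).

Lemma chain_fst K : chain K -> chain [set s.1 | s in K].
Proof.
move=> chK _ _ [s Ks <-] [t Kt <-].
by have [|] := chK s t Ks Kt; rewrite Order.ProdOrder.leEprod => /andP[];
  [left|right].
Qed.

Lemma chain_snd K : chain K -> chain [set s.2 | s in K].
Proof.
move=> chK _ _ [s Ks <-] [t Kt <-].
by have [|] := chK s t Ks Kt; rewrite Order.ProdOrder.leEprod => /andP[];
  [left|right].
Qed.

Lemma ubound_pair K a b :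
  ubound K (a, b) <-> ubound [set s.1 | s in K] a /\ ubound [set s.2 | s in K] b.
Proof.
split=> [ub|[ua ub] s Ks].
  by split=> _ [s Ks <-]; have /andP[] := ub s Ks.
by rewrite Order.ProdOrder.leEprod ua ?ub//; exists s.
Qed.

Lemma chain_complete_setX C D : chain_complete C -> chain_complete D ->
  chain_complete (C `*` D : set (X *p Y)).
Proof.
move=> ccC ccD K KCD [s0 Ks0] chK.
have [||a [Ca aub alub]] := ccC [set s.1 | s in K] _ _ (chain_fst _ chK).
- by move=> _ [s /KCD[? _] <-].
- by exists s0.1, s0.
have [||b [Db bub blub]] := ccD [set s.2 | s in K] _ _ (chain_snd _ chK).
- by move=> _ [s /KCD[_ ?] <-].
- by exists s0.2, s0.
exists (a, b); split=> //; first exact/ubound_pair.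
move=> [a' b'] [Ca' Db'] /ubound_pair[a'ub b'ub].
by rewrite Order.ProdOrder.leEprod /= alub// blub.
Qed.

Lemma universally_inductive_setX C D A B :
  universally_inductive C A -> universally_inductive D B ->
  universally_inductive (C `*` D : set (X *p Y)) (A `*` B).
Proof.
move=> [AC [a0 Aa0] indA] [BD [b0 Bb0] indB]; split.
- by move=> [x y] [/AC ? /BD ?].
- by exists (a0, b0).
move=> K KCD chK Kdom.
have [||a Aa aub] := indA [set s.1 | s in K] _ (chain_fst _ chK).
- by move=> _ [s /KCD[? _] <-].
- move=> _ [s /Kdom[[x y] [/= Ax _]] /andP[sx _] <-].
  by exists x.
have [||b Bb bub] := indB [set s.2 | s in K] _ (chain_snd _ chK).
- by move=> _ [s /KCD[_ ?] <-].
- move=> _ [s /Kdom[[x y] [/= _ By]] /andP[_ sy] <-].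
  by exists y.
by exists (a, b) => //; exact/ubound_pair.
Qed.

(** The factors are crossed: the new first coordinate is chosen from the old
    second one and conversely, so that a fixed point is a pair of mutual
    responses. *)
Definition equilibrium_map (p : X -> set Y) (q : Y -> set X) :
    X *p Y -> set (X *p Y) :=
  fun s => q s.2 `*` p s.1.

Lemma equilibrium_map_increasing C D (p : X -> set Y) (q : Y -> set X) :
  order_increasing_upward C p -> order_increasing_upward D q ->
  order_increasing_upward (C `*` D : set (X *p Y)) (equilibrium_map p q).
Proof.
move=> pincr qincr [x1 y1] [x2 y2] [/= Cx1 Dy1] [/= Cx2 Dy2] /andP[/= x12 y12].
move=> [u v] [/= qu pv].
have [u' qu' uu'] := qincr _ _ Dy1 Dy2 y12 _ qu.
have [v' pv' vv'] := pincr _ _ Cx1 Cx2 x12 _ pv.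
by exists (u', v') => //; rewrite Order.ProdOrder.leEprod /= uu'.
Qed.

End Products.

(** The two inequalities defining a solution are maximality of [T x y] over
    [G y] in the first argument and its minimality over [F x] in the second. *)
Lemma ROEP_solutions_fixed_points {dX dY dU : Order.disp_t}
    {X : porderType dX} {Y : porderType dY} {U : porderType dU}
    (C : set X) (D : set Y) (T : X -> Y -> U) (F : X -> set Y)
    (G : Y -> set X) :
  ROEP_solutions C D T F G =
  fixed_points (C `*` D : set (X *p Y)) (equilibrium_map (phi T F) (psi T G)).
Proof.
apply/seteqP; split=> -[x y].
  move=> [/= Cx Dy Gx Fy eq]; split=> //; split; split=> //=; split.
  - by exists x.
  - by move=> _ [u Gu <-]; exact: (eq u y Gu Fy).1.
  - by exists y.
  - by move=> _ [v Fv <-]; exact: (eq x v Gx Fv).2.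
move=> [[/= Cx Dy] [[/= Gx [_ Tmax]] [/= Fy [_ Tmin]]]]; split=> //= u v Gu Fv.
by split; [apply: Tmax; exists u|apply: Tmin; exists v].
Qed.

Theorem theorem3p1 (dX dY dU : Order.disp_t)
    (X : porderType dX) (Y : porderType dY) (U : porderType dU)
    (C : set X) (D : set Y)
    (T : X -> Y -> U) (F : X -> set Y) (G : Y -> set X)
    (C0 : C !=set0) (D0 : D !=set0)
    (ccC : chain_complete C) (ccD : chain_complete D)
    (hF : setvalued C D F) (hG : setvalued D C G)
    (hphi : setvalued C D (phi T F)) (hpsi : setvalued D C (psi T G))
    (phi_incr : order_increasing_upward C (phi T F))
    (psi_incr : order_increasing_upward D (psi T G))
    (phi_ind : forall x, C x -> universally_inductive D (phi T F x))
    (psi_ind : forall y, D y -> universally_inductive C (psi T G y))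
    (hstart : exists x' y' u' z', [/\ C x' /\ D y', phi T F x' u',
       psi T G y' z', x' <= z' & y' <= u']) :
  [/\ ROEP_solutions C D T F G `<=` C `*` D,
      ROEP_solutions C D T F G !=set0,
      inductive (ROEP_solutions C D T F G) &
      exists s, maximal_in (ROEP_solutions C D T F G) s].
Proof.
have cc := chain_complete_setX _ _ ccC ccD.
have incr := equilibrium_map_increasing _ _ _ _ phi_incr psi_incr.
have ind s : (C `*` D) s ->
    universally_inductive (C `*` D : set (X *p Y))
      (equilibrium_map (phi T F) (psi T G) s).
  move=> [Cs Ds]; apply: universally_inductive_setX.
    exact: psi_ind.
  exact: phi_ind.
have start : postfixed_points (C `*` D : set (X *p Y))
    (equilibrium_map (phi T F) (psi T G)) !=set0.
  have [x [y [u [z [CD pu pz xz yu]]]]] := hstart.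
  exists (x, y); split=> //; exists (z, u) => //.
  by rewrite Order.ProdOrder.leEprod /= xz.
rewrite ROEP_solutions_fixed_points.
have [m mmax] := fixed_points_maximal _ _ cc incr ind start.
split; [by move=> s []|by exists m; exact: mmax.1| |by exists m].
exact: fixed_points_inductive.
Qed.
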